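(* There is an absolute constant $K$ such that the following holds. Let $k,n$ be integers larger than $1$, and let $w$ be the width of $[k]^n$. If $\mathcal{F}\subset[k]^n$ does not contain three distinct elements $\mathbf u,\mathbf v,\mathbf w$ with $\mathbf u=\mathbf v\vee\mathbf w$, then $|\mathcal{F}|\le K w$.
   Context: $[k]^n=\{1,\dots,k\}^n$ with the coordinatewise order; its width is the size of its largest antichain. For $\mathbf v,\mathbf w\in[k]^n$, $\mathbf v\vee\mathbf w=(\max\{\mathbf v(1),\mathbf w(1)\},\dots,\max\{\mathbf v(n),\mathbf w(n)\})$. *)

(* Defs.v *)
From mathcomp Require Import all_boot.
Set Implicit Arguments. Unset Strict Implicit. Unset Printing Implicit Defensive.

(* [k]^n, with [k] = {1..k} represented by 'I_k = {0..k-1} (order-isomorphic). *)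
Definition grid (k n : nat) := {ffun 'I_n -> 'I_k}.

Definition gle (k n : nat) (v w : grid k n) : bool := [forall i, v i <= w i].

Definition gjoin (k n : nat) (v w : grid k n) : grid k n :=
  [ffun i => if v i <= w i then w i else v i].

Definition antichain (k n : nat) (A : {set grid k n}) : bool :=
  [forall v in A, forall w in A, gle v w ==> (v == w)].

Definition width (k n : nat) : nat :=
  \max_(A : {set grid k n} | antichain A) #|A|.

(* Main.v *)
(** Write [k]^n as a product of two halves. If (x, y) lies in F and neither y is
    minimal in the fibre of F over x nor x is minimal in the fibre over y, then
    (x, y) = (x, y') \/ (x', y) with both joinands in F; hence a union-free F has at most
    k^a w(b) + k^b w(a) elements, n = a + b. It remains to see that w(m) / k^m
    and w(2m) / k^(2m) are of the same order. A symmetric chain decomposition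
    bounds w(m) by the middle level N(c); the level sizes N(s) of [k]^m are
    log-concave, which gives N(c) k^m <= 8 sum_s N(s)^2; and the pairs (x, y) with
    rank x equal to the rank of the complement of y form an antichain of [k]^(2m)
    of size sum_s N(s)^2. *)
Require Import Defs.
From mathcomp Require Import all_boot all_order all_algebra zify.
Set Implicit Arguments. Unset Strict Implicit. Unset Printing Implicit Defensive.

(** * Ranks, and sums of squares of log-concave sequences *)

Definition rank k n (v : grid k n) : nat := \sum_i v i.

Definition level k n (s : nat) : {set grid k n} := [set v | rank v == s].

Lemma sum_ord_shift (f : nat -> nat) c B : c <= B ->
  \sum_(s < B) f s = \sum_(s < c) f s + \sum_(s < B - c) f (c + s).
Proof.
move=> cB; rewrite -(big_mkord xpredT f) (big_cat_nat (leq0n c) cB) //= big_mkord.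
have -> : \sum_(c <= i < B) f i = \sum_(0 + c <= i < B) f i by [].
by rewrite big_addn big_mkord; congr addn; apply: eq_bigr => i _; rewrite addnC.
Qed.

(* If t is the first index with g t < g 0 / 2, then g (t + s) <= g s / 2, so at least
   half of the mass of g sits on [0, t), where g is at least g 0 / 2. *)
Lemma logconcave_sum_sq (g : nat -> nat) (B : nat) :
  (forall s t, s + t < B -> g (s + t) * g 0 <= g s * g t) ->
  g 0 * \sum_(s < B) g s <= 4 * \sum_(s < B) g s ^ 2.
Proof.
move=> gM; have [->|g0] := posnP (g 0); first by rewrite mul0n.
have high C : (forall s, s < C -> g 0 <= 2 * g s) ->
  g 0 * \sum_(s < C) g s <= 2 * \sum_(s < C) g s ^ 2.
  move=> hC; rewrite !big_distrr; apply: leq_sum => s _.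
  by rewrite /= -mulnn mulnA leq_mul2r hC ?orbT.
have [/forallP hB|] := boolP [forall s : 'I_B, g 0 <= 2 * g s].
  apply: leq_trans (high B _) _; last by rewrite leq_mul2r orbT.
  by move=> s sB; exact: (hB (Ordinal sB)).
rewrite negb_forall => /existsP[[s0 /= s0B] ls0].
have ex : exists s, 2 * g s < g 0 by exists s0; rewrite ltnNge.
case: (ex_minnP ex) => t lt mint.
have tB : t <= B.
  by apply: leq_trans (ltnW s0B); apply: mint; rewrite ltnNge.
have ht : g 0 * \sum_(s < t) g s <= 2 * \sum_(s < t) g s ^ 2.
  by apply: high => s st; rewrite leqNgt; apply/negP => /mint; rewrite leqNgt st.
have tail : 2 * \sum_(s < B - t) g (t + s) <= \sum_(s < B - t) g s.
  rewrite big_distrr; apply: leq_sum => -[s /= sB] _.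
  have := gM t s; rewrite -ltn_subRL => /(_ sB) h.
  by rewrite -(leq_pmul2l g0); nia.
have sub : \sum_(s < B - t) g s <= \sum_(s < B) g s.
  by rewrite (big_ord_widen B g) ?leq_subr // big_mkcond leq_sum // => s _; case: ifP.
rewrite (sum_ord_shift (fun s => g s ^ 2) tB) mulnDr.
apply: leq_trans (leq_addr _ _).
(* The constant 4 is 2 for discarding the tail times 2 for the bound on [0, t). *)
apply: (@leq_trans (g 0 * (2 * \sum_(s < t) g s))); last by rewrite mulnCA; lia.
rewrite leq_pmul2l // mul2n -addnn (sum_ord_shift g tB) leq_add2l.
move: (leq_trans tail sub); rewrite (sum_ord_shift g tB) mul2n -addnn leq_add2r; exact.
Qed.

(** * Log-concavity of the level sizes *)

Section LogConcave.

Import GRing.Theory Num.Theory Order.TTheory.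
Local Open Scope ring_scope.

(** This form, unlike the three-term one, also excludes internal zeros, so it survives
    convolution. *)
Definition logconcave (a : int -> nat) :=
  forall x y z w : int, x <= y -> x <= z -> x + w = y + z ->
    (a x * a w <= a y * a z)%N.

(** Both ends move inward one unit at a time, from x, w to y, z. *)
Lemma logconcave_adjacent (a : int -> nat) :
  (forall i j : int, i <= j -> (a i * a (j + 1)%R <= a (i + 1)%R * a j)%N) ->
  logconcave a.
Proof.
move=> adj.
have step (t : nat) (x w : int) : x + t%:Z <= w - t%:Z ->
    (a x * a w <= a (x + t%:Z)%R * a (w - t%:Z)%R)%N.
  elim: t x w => [|t IH] x w h; first by rewrite addr0 !subr0.
  have h1 : x <= w - 1 by lia.
  have h2 : x + 1 + t%:Z <= w - 1 - t%:Z by lia.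
  have := adj _ _ h1; rewrite subrK => /leq_trans; apply.
  have -> : x + t.+1%:Z = x + 1 + t%:Z by lia.
  have -> : w - t.+1%:Z = w - 1 - t%:Z by lia.
  exact: IH.
move=> x y z w xy xz e.
wlog yz : y z xy xz e / y <= z.
  move=> H; have [h|h] := leP y z; first exact: H.
  by rewrite (mulnC (a y)); apply: H => //; lia.
have := step `|y - x|%N x w.
have -> : x + (absz (y - x))%:Z = y by lia.
have -> : w - (absz (y - x))%:Z = z by lia.
exact.
Qed.

(** The windows at i and i + 1 share all but one term each, with common part [P]; those at j and j +
    1 share [Q]. After expansion the products [P * Q] cancel and the other three pairs compare
    separately. *)
Lemma logconcave_window (a : int -> nat) (k : nat) :
  logconcave a -> logconcave (fun z => \sum_(j < k) a (z - j%:Z)%R)%N.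
Proof.
move=> LC; case: k => [|k]; first by move=> x y z w _ _ _; rewrite !big_ord0.
apply: logconcave_adjacent => i j ij.
pose P := (\sum_(t < k) a (i - t%:Z)%R)%N.
pose Q := (\sum_(t < k) a (j - t%:Z)%R)%N.
have lo z : (\sum_(t < k.+1) a (z - t%:Z)%R = \sum_(t < k) a (z - t%:Z)%R + a (z - k%:Z)%R)%N.
  by rewrite big_ord_recr.
have hi z : (\sum_(t < k.+1) a (z + 1 - t%:Z)%R = a (z + 1)%R + \sum_(t < k) a (z - t%:Z)%R)%N.
  rewrite big_ord_recl subr0; congr addn; apply: eq_bigr => t _.
  by congr a; rewrite lift0; lia.
rewrite (lo i) (lo j) !hi -/P -/Q.
have h1 : (P * a (j + 1)%R <= a (i + 1)%R * Q)%N.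
  by rewrite /P /Q big_distrl big_distrr; apply: leq_sum => t _; apply: LC; lia.
have h2 : (a (i - k%:Z)%R * Q <= P * a (j - k%:Z)%R)%N.
  rewrite /P /Q big_distrl big_distrr /= (reindex_inj rev_ord_inj).
  rewrite [leqRHS](reindex_inj rev_ord_inj) /=; apply: leq_sum => t _.
  by apply: LC; have := ltn_ord t; lia.
have h3 : (a (i - k%:Z)%R * a (j + 1)%R <= a (i + 1)%R * a (j - k%:Z)%R)%N.
  by apply: LC; lia.
move: h1 h2 h3; clearbody P Q; move: (a (j + 1)%R) (a (i + 1)%R) (a (i - k%:Z)%R) (a (j - k%:Z)%R).
move=> w x y z; nia.
Qed.

(* Zero-extended to negative indices so that windows need no boundary case. *)
Definition coefz (p : {poly nat}) (z : int) : nat :=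
  if z is Posz s then (p`_s)%R else 0%N.

(** The rank generating function of one coordinate; its n-th power is that of [k]^n. *)
Definition window (k : nat) : {poly nat} := \sum_(j < k) 'X^j.

Lemma coefz_window (k : nat) (p : {poly nat}) (z : int) :
  coefz (p * window k) z = (\sum_(j < k) coefz p (z - j%:Z)%R)%N.
Proof.
rewrite /window mulr_sumr; case: z => s /=; last first.
  by rewrite big1 // => j _; have -> : Negz s - j%:Z = Negz (s + j) by lia.
rewrite coef_sum; apply: eq_bigr => j _; rewrite coefMXn.
case: ltnP => h; last by have -> : Posz s - j%:Z = Posz (s - j) by lia.
by have -> : Posz s - j%:Z = Negz (j - s).-1 by lia.
Qed.

Lemma logconcave_window_exp (k n : nat) : logconcave (coefz (window k ^+ n)).
Proof.
elim: n => [|n IH].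
  have c1 (z : int) : coefz (window k ^+ 0) z = (z == 0).
    by rewrite expr0; case: z => s //=; rewrite coef1; case: s.
  move=> x y z w xy xz e; rewrite !c1.
  have [x0|] := eqVneq x 0; last by rewrite mul0n.
  have [w0|] := eqVneq w 0; last by rewrite muln0.
  by have [-> ->] : y = 0 /\ z = 0 by lia.
move=> x y z w xy xz e; rewrite exprSr !coefz_window.
exact: (logconcave_window k IH).
Qed.

Lemma card_level (k n s : nat) : #|level k n s| = ((window k ^+ n)`_s)%R.
Proof.
rewrite -[n in RHS]card_ord -prodr_const /window (bigA_distr_bigA (fun=> fun j : 'I_k => 'X^j)).
rewrite coef_sum -sum1_card big_mkcond; apply: eq_bigr => v _.
by rewrite prodrXr coefXn inE /rank eq_sym; case: eqP.
Qed.

End LogConcave.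

Lemma level_logconcave (k n x y z w : nat) : x <= y -> x <= z -> x + w = y + z ->
  #|level k n x| * #|level k n w| <= #|level k n y| * #|level k n z|.
Proof.
move=> xy xz e; rewrite !card_level.
by apply: (logconcave_window_exp k n (x := x) (y := y) (z := z) (w := w)); lia.
Qed.

(** * Symmetric chains and the middle level *)

Section ChainLabel.

Variable k : nat.

Definition psum (x : nat -> nat) (m : nat) : nat := \sum_(i < m) x i.

(* Symmetric chain decomposition, encoded by labels. Crossing a chain of [k]^m, of
   ranks b .. m(k-1) - b, with [k] gives a rectangle that splits into hooks; x lies on
   the hook of index minn (x m) (m(k-1) - b - rank). [bottom x m] is the rank of the
   bottom of the chain through the first m coordinates of x, and two points lie on the
   same chain iff their sequences of [bottom]s agree. *)
Fixpoint bottom (x : nat -> nat) (m : nat) : nat :=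
  if m is m'.+1 then
    bottom x m' + minn (x m') (m' * k.-1 - bottom x m' - psum x m')
  else 0.

(** These bounds make the truncated subtractions in [bottom] exact. *)
Lemma bottom_psum x m : (forall i, i < m -> x i < k) ->
  bottom x m <= psum x m /\ psum x m + bottom x m <= m * k.-1.
Proof.
elim: m => [|m IH] xk /=; first by rewrite /psum big_ord0.
have [|] := IH; first by move=> i im; apply: xk; lia.
by have := xk m (ltnSn m); rewrite {4 5}/psum big_ord_recr /= -/(psum x m); nia.
Qed.

Lemma eq_psum x y m : (forall i, i < m -> x i = y i) -> psum x m = psum y m.
Proof. by move=> e; apply: eq_bigr => i _; apply: e. Qed.

Lemma eq_bottom x y m : (forall i, i < m -> x i = y i) -> bottom x m = bottom y m.
Proof.
elim: m => [|m IH] e //=.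
have e' i : i < m -> x i = y i by move=> im; apply: e; lia.
by rewrite IH // (eq_psum e') e.
Qed.

(** Along a hook minn u (T - r) = h, first r grows to T - h with u = h, then u grows. So the prefix
    rank r and the last coordinate u never move in opposite directions. *)
Lemma same_label_comparable x y m :
  (forall i, i < m -> x i < k) -> (forall i, i < m -> y i < k) ->
  (forall i, i <= m -> bottom x i = bottom y i) ->
  psum x m <= psum y m -> forall i, i < m -> x i <= y i.
Proof.
elim: m x y => [|m IH] x y xk yk e //.
have xk' i : i < m -> x i < k by move=> im; apply: xk; lia.
have yk' i : i < m -> y i < k by move=> im; apply: yk; lia.
have e' i : i <= m -> bottom x i = bottom y i by move=> im; apply: e; lia.
rewrite /psum !big_ord_recr /= -/(psum x m) -/(psum y m) => le_xy i.
have := e m.+1 (leqnn _); rewrite /= e' //.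
have := e' m (leqnn m).
have [] := bottom_psum xk'; have [] := bottom_psum yk'.
have [xy|yx] := leqP (psum x m) (psum y m) => h1 h2 h3 h4 h5 h6.
  rewrite ltnS leq_eqVlt => /orP[/eqP ->|]; first by lia.
  exact: IH.
have := IH y x yk' xk' (fun i im => esym (e' i im)) (ltnW yx).
by lia.
Qed.

(** A symmetric chain skips no rank between its bottom and the mirror image of its bottom. *)
Lemma chain_rank x m c : (forall i, i < m -> x i < k) ->
  bottom x m <= c -> c + bottom x m <= m * k.-1 ->
  exists y, [/\ forall i, i < m -> y i < k,
    forall i, i <= m -> bottom y i = bottom x i & psum y m = c].
Proof.
elim: m c => [|m IH] c xk lo hi.
  by exists x; split=> //; rewrite /psum big_ord0; lia.
have xk' i : i < m -> x i < k by move=> im; apply: xk; lia.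
have xm := xk m (ltnSn m).
have [l1 l2] := bottom_psum xk'.
move: lo hi => /=; set T := m * k.-1 - bottom x m; set h := minn _ _ => lo hi.
have hT : h <= T - psum x m by rewrite /h; lia.
have hx : h <= x m by rewrite /h; lia.
(* The point of rank c on the hook: on the leg u = h if c <= T, on the leg r = T - h otherwise. *)
have [r [u [uk rlo rhi cE hE]]] : exists r u, [/\ u < k, bottom x m <= r,
    r + bottom x m <= m * k.-1, c = r + u & minn u (T - r) = h].
  have [?|?] := leqP c T.
    by exists (c - h), h; split; rewrite /T in hT *; lia.
  by exists (T - h), (c - (T - h)); split; rewrite /T in hT *; lia.
have [y [yk yb yr]] := IH r xk' rlo rhi.
pose z i := if i == m then u else y i.
have zy i : i < m -> z i = y i by rewrite /z; case: eqP => //; lia.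
exists z; split.
- by move=> i; rewrite ltnS leq_eqVlt /z; case: eqP => //= _; exact: yk.
- have bz i : i <= m -> bottom z i = bottom x i.
    move=> im; rewrite -yb //; apply: eq_bottom => j ji; apply: zy; lia.
  move=> i; rewrite leq_eqVlt => /orP[/eqP ->|]; last exact: bz.
  by rewrite /= bz // (eq_psum zy) yr -/T -/h {1}/z eqxx hE.
- by rewrite /psum big_ord_recr /= -/(psum z m) (eq_psum zy) yr {1}/z eqxx.
Qed.

End ChainLabel.

(** Extension by 0 to all of nat, since [bottom] recurses on prefixes of a sequence. *)
Definition coord k n (v : grid k n) (i : nat) : nat :=
  if insub i is Some j then v j else 0.

Lemma coordE k n (v : grid k n) (i : 'I_n) : coord v i = v i.
Proof. by rewrite /coord valK. Qed.

Lemma coord_lt k n (v : grid k n) i : i < n -> coord v i < k.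
Proof. by move=> ilt; rewrite (coordE v (Ordinal ilt)). Qed.

Lemma psum_coord k n (v : grid k n) : psum (coord v) n = rank v.
Proof. by apply: eq_bigr => i _; rewrite coordE. Qed.

Lemma coord_onto k n (x : nat -> nat) : (forall i, i < n -> x i < k) ->
  exists v : grid k n, forall i, i < n -> coord v i = x i.
Proof.
move=> xk; exists [ffun i : 'I_n => Ordinal (xk i (ltn_ord i))] => i ilt.
by rewrite (coordE _ (Ordinal ilt)) ffunE.
Qed.

Lemma antichain_eq k n (A : {set grid k n}) u v :
  antichain A -> u \in A -> v \in A -> gle u v -> u = v.
Proof.
by move=> /forallP/(_ u)/implyP h uA vA le; apply/eqP;
  move: (h uA) => /forallP/(_ v)/implyP/(_ vA)/implyP; apply.
Qed.

(** Each point is sent to a middle-rank point of its own chain. Points with the same image lie on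
    one chain, hence are comparable, so the map is injective on an antichain. *)
Lemma width_level k n : width k n <= #|level k n (n * k.-1)./2|.
Proof.
apply/bigmax_leqP => A acA; set c := _./2.
have cE : c.*2 <= n * k.-1 <= c.*2.+1 by rewrite /c; lia.
have ex (v : grid k n) : exists w : grid k n, (w \in level k n c) &&
    [forall i : 'I_n.+1, bottom k (coord w) i == bottom k (coord v) i].
  have [|l1 l2] := @bottom_psum k (coord v) n; first exact: coord_lt.
  have [|||y [yk yb yr]] := @chain_rank k (coord v) n c; try lia.
    exact: coord_lt.
  have [w wy] := coord_onto yk; exists w.
  rewrite inE -psum_coord (eq_psum wy) yr eqxx /=; apply/forallP => i.
  rewrite -yb ?leq_ord //; apply/eqP/eq_bottom => j ji; apply: wy.
  by have := ltn_ord i; lia.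
pose f v := xchoose (ex v).
have fE v : (f v \in level k n c) &&
    [forall i : 'I_n.+1, bottom k (coord (f v)) i == bottom k (coord v) i].
  exact: xchooseP (ex v).
have fb v i : i <= n -> bottom k (coord (f v)) i = bottom k (coord v) i.
  move=> ilt; have /andP[_ /forallP/(_ (Ordinal (ilt : i < n.+1)))/eqP] := fE v; exact.
rewrite -(card_in_imset (f := f)).
  by apply/subset_leq_card/subsetP => _ /imsetP[v _ ->]; case/andP: (fE v).
move=> u v uA vA e; wlog uv : u v uA vA e / rank u <= rank v.
  by move=> H; have [/H|/ltnW/H h] := leqP (rank u) (rank v); [exact|exact/esym/h].
apply: antichain_eq uA vA _ => //; apply/forallP => i; rewrite -!coordE.
apply: (@same_label_comparable k (coord u) (coord v) n) => //.
- exact: coord_lt.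
- exact: coord_lt.
- by move=> j jn; rewrite -fb // e fb.
- by rewrite !psum_coord.
Qed.

(** * Products of grids and the union-free bound *)

Definition glue k a b (x : grid k a) (y : grid k b) : grid k (a + b) :=
  [ffun i => match split i with inl j => x j | inr j => y j end].

Definition gfst k a b (v : grid k (a + b)) : grid k a := [ffun i => v (lshift b i)].

Definition gsnd k a b (v : grid k (a + b)) : grid k b := [ffun i => v (rshift a i)].

Lemma gfstK k a b (x : grid k a) (y : grid k b) : gfst (glue x y) = x.
Proof. by apply/ffunP => i; rewrite !ffunE (unsplitK (inl i)). Qed.

Lemma gsndK k a b (x : grid k a) (y : grid k b) : gsnd (glue x y) = y.
Proof. by apply/ffunP => i; rewrite !ffunE (unsplitK (inr i)). Qed.

Lemma glueK k a b (v : grid k (a + b)) : glue (gfst v) (gsnd v) = v.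
Proof.
by apply/ffunP => i; rewrite !ffunE; case: splitP => j ij; rewrite ffunE;
  congr (v _); apply: val_inj.
Qed.

Lemma glue_inj k a b (x x' : grid k a) (y y' : grid k b) :
  glue x y = glue x' y' -> x = x' /\ y = y'.
Proof. by move=> e; split; [rewrite -(gfstK x y) e gfstK|rewrite -(gsndK x y) e gsndK]. Qed.

Lemma gle_glue k a b (x x' : grid k a) (y y' : grid k b) :
  gle (glue x y) (glue x' y') = gle x x' && gle y y'.
Proof.
apply/forallP/andP => [h|[/forallP hx /forallP hy] i].
  split; apply/forallP => i.
    by have := h (lshift b i); rewrite !ffunE (unsplitK (inl i)).
  by have := h (rshift a i); rewrite !ffunE (unsplitK (inr i)).
by rewrite !ffunE; case: split.
Qed.

Lemma gle_refl k n (v : grid k n) : gle v v.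
Proof. exact/forallP. Qed.

Lemma gjoin_glue k a b (x x' : grid k a) (y y' : grid k b) :
  gle x' x -> gle y' y -> gjoin (glue x y') (glue x' y) = glue x y.
Proof.
move=> /forallP hx /forallP hy; apply/ffunP => i; rewrite !ffunE.
case: split => j; case: leqP => // h; apply: val_inj; apply/eqP; rewrite eqn_leq.
  by rewrite hx h.
by rewrite (hy j) ltnW.
Qed.

Lemma leq_width k n (A : {set grid k n}) : antichain A -> #|A| <= width k n.
Proof. by move=> acA; rewrite /width (bigmax_sup A). Qed.

Lemma card_grid k n : #|grid k n| = k ^ n.
Proof. by rewrite card_ffun !card_ord. Qed.

Lemma card_glue k a b (F : {set grid k (a + b)}) :
  #|F| = \sum_(x : grid k a) #|[set y : grid k b | glue x y \in F]|.
Proof.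
rewrite -sum1_card (reindex (fun p : grid k a * grid k b => glue p.1 p.2)) /=; last first.
  exists (fun v => (gfst v, gsnd v)) => [[x y]|v] _ /=; first by rewrite gfstK gsndK.
  exact: glueK.
rewrite (eq_bigl (fun p : grid k a * grid k b => xpredT p.1 && (glue p.1 p.2 \in F))) //.
rewrite -(pair_big_dep xpredT (fun x y => glue x y \in F) (fun _ _ => 1)) /=.
by apply: eq_bigr => x _; rewrite sum1dep_card; apply: eq_card => y; rewrite inE.
Qed.

Lemma card_glue_r k a b (F : {set grid k (a + b)}) :
  #|F| = \sum_(y : grid k b) #|[set x : grid k a | glue x y \in F]|.
Proof.
rewrite card_glue; under eq_bigr do rewrite -sum1_card big_mkcond.
rewrite exchange_big; apply: eq_bigr => y _.
rewrite -sum1_card [RHS]big_mkcond; apply: eq_bigr => x _.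
by rewrite !inE.
Qed.

Lemma antichainP k n (A : {set grid k n}) :
  (forall u v, u \in A -> v \in A -> gle u v -> u = v) -> antichain A.
Proof.
move=> h; apply/forallP => u; apply/implyP => uA; apply/forallP => v.
by apply/implyP => vA; apply/implyP => le; apply/eqP; apply: h.
Qed.

Lemma card_fibers_width k a b (F : {set grid k (a + b)}) :
  (forall x y y', glue x y \in F -> glue x y' \in F -> gle y y' -> y = y') ->
  #|F| <= k ^ a * width k b.
Proof.
move=> h; rewrite card_glue -card_grid -sum_nat_const; apply: leq_sum => x _.
by apply/leq_width/antichainP => y y'; rewrite !inE; apply: h.
Qed.

Lemma card_fibers_width_r k a b (F : {set grid k (a + b)}) :
  (forall x x' y, glue x y \in F -> glue x' y \in F -> gle x x' -> x = x') ->
  #|F| <= k ^ b * width k a.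
Proof.
move=> h; rewrite card_glue_r -card_grid -sum_nat_const; apply: leq_sum => y _.
by apply/leq_width/antichainP => x x'; rewrite !inE; apply: h.
Qed.

Lemma width_add k a b : width k (a + b) <= k ^ b * width k a.
Proof.
apply/bigmax_leqP => A acA; apply: card_fibers_width_r => x x' y xA x'A le.
by case: (glue_inj (antichain_eq acA xA x'A _)) => //; rewrite gle_glue le gle_refl.
Qed.

Lemma union_free_width k a b (F : {set grid k (a + b)}) :
  (forall u v w, u \in F -> v \in F -> w \in F ->
     u != v -> u != w -> v != w -> u <> gjoin v w) ->
  #|F| <= k ^ a * width k b + k ^ b * width k a.
Proof.
move=> free.
(* D: the points whose second component is not minimal in its fibre. *)
pose D := [set u in F | [exists y : grid k b,
  [&& glue (gfst u) y \in F, gle y (gsnd u) & y != gsnd u]]].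
rewrite -(cardsID D F) addnC; apply: leq_add.
  apply: card_fibers_width => x y y' /setDP[yF _] /setDP[y'F y'D] le.
  apply/eqP; apply: contraNT y'D => ne; rewrite inE y'F /=.
  by apply/existsP; exists y; rewrite gfstK gsndK yF le.
(* If x < x' over the same y, then (x', y) is the join of (x', y') and (x, y), where y' < y comes
   from [D]. *)
apply: card_fibers_width_r => x x' y /setIP[xF _] /setIP[x'F].
rewrite inE x'F gfstK gsndK /= => /existsP[y' /and3P[y'F y'y ney]] xx'.
apply/eqP; apply/negPn/negP => nex.
apply: (free (glue x' y) (glue x' y') (glue x y)) => //.
- by apply: contra ney => /eqP/glue_inj[_ ->].
- by apply: contra nex => /eqP/glue_inj[-> _].
- by apply: contra nex => /eqP/glue_inj[-> _].
- by rewrite gjoin_glue.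
Qed.

(** * Level sizes and the width of the doubled grid *)

Definition grev k n (v : grid k n) : grid k n := [ffun i => rev_ord (v i)].

Lemma grevK k n : involutive (@grev k n).
Proof. by move=> v; apply/ffunP => i; rewrite !ffunE rev_ordK. Qed.

Lemma gle_grev k n (u v : grid k n) : gle (grev u) (grev v) = gle v u.
Proof.
apply/forallP/forallP => h i; have := h i; rewrite !ffunE /=;
  by have := ltn_ord (u i); have := ltn_ord (v i); lia.
Qed.

Lemma rank_inj k n (u v : grid k n) : gle u v -> rank u = rank v -> u = v.
Proof.
move=> /forallP uv e; apply/ffunP => i; apply: val_inj => /=.
have /leqif_sum/leqifP : forall i, true -> val (u i) <= val (v i) ?= iff (val (u i) == val (v i)).
  by move=> j _; split; first exact: uv.
rewrite -/(rank u) -/(rank v); case: ifP => [/forallP/(_ i)/eqP //|_].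
by rewrite e ltnn.
Qed.

Lemma rank_mono k n (u v : grid k n) : gle u v -> rank u <= rank v.
Proof. by move=> /forallP uv; apply: leq_sum. Qed.

Lemma sum_level_sq_width k n B :
  \sum_(s < B) #|level k n s| ^ 2 <= width k (n + n).
Proof.
pose A := [set u : grid k (n + n) | rank (gfst u) == rank (grev (gsnd u))].
have acA : antichain A.
  apply: antichainP => u v; rewrite !inE -(glueK u) -(glueK v) gle_glue !gfstK !gsndK.
  move=> /eqP eu /eqP ev /andP[le1 le2].
  have le3 : gle (grev (gsnd v)) (grev (gsnd u)) by rewrite gle_grev.
  have := rank_mono le1; have := rank_mono le3 => h1 h2.
  (* From u to v the rank of the first half can only rise and that of the complemented second half
     only fall; being equal, both stay constant. *)
  have -> : gfst u = gfst v by apply: rank_inj => //; lia.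
  have e : grev (gsnd v) = grev (gsnd u) by apply: rank_inj => //; lia.
  by rewrite -[gsnd u]grevK -e grevK.
apply: leq_trans (leq_width acA); rewrite card_glue_r.
have fib (y : grid k n) : [set x | glue x y \in A] = level k n (rank (grev y)).
  by apply/setP => x; rewrite !inE gfstK gsndK.
under [leqRHS]eq_bigr do rewrite fib.
rewrite [leqRHS](reindex_inj (inv_inj (@grevK k n))) /=.
under [leqRHS]eq_bigr do rewrite grevK.
(* Each y of rank s contributes a fibre of the size of its own level, which gives the square. *)
have part s : #|level k n s| ^ 2 = \sum_(y in level k n s) #|level k n (rank y)|.
  rewrite (eq_bigr (fun=> #|level k n s|)); first by rewrite sum_nat_const mulnn.
  by move=> y; rewrite inE => /eqP ->.
under eq_bigr do rewrite part big_mkcond.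
rewrite exchange_big; apply: leq_sum => y _.
rewrite -big_mkcond /=.
have [yB|By] := ltnP (rank y) B.
  rewrite (big_pred1 (Ordinal yB)) // => s.
  by rewrite inE eq_sym.
rewrite big1 // => s; rewrite inE => /eqP e.
by move: By; rewrite e leqNgt ltn_ord.
Qed.

Lemma sum_level k n : \sum_(s < (n * k.-1).+1) #|level k n s| = k ^ n.
Proof.
rewrite -card_grid -sum1_card.
have rlt (v : grid k n) : rank v < (n * k.-1).+1.
  rewrite ltnS /rank -[n in n * _]card_ord -sum_nat_const; apply: leq_sum => i _.
  by case: (v i) => j /=; lia.
rewrite (partition_big (fun v : grid k n => Ordinal (rlt v)) xpredT) //=.
apply: eq_bigr => s _; rewrite -sum1_card; apply: eq_bigl => v.
by rewrite inE -val_eqE.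
Qed.

Lemma sum_ord_rev (f : nat -> nat) c :
  \sum_(s < c.+1) f (c - s) = \sum_(s < c.+1) f s.
Proof. by rewrite [RHS](reindex_inj rev_ord_inj). Qed.

(** The sequence is read outward from c in both directions, each with constant 4. The two sums of
    squares are each at most the full one, hence 8. *)
Lemma level_sum_sq k n c B : c < B ->
  #|level k n c| * \sum_(s < B) #|level k n s| <= 8 * \sum_(s < B) #|level k n s| ^ 2.
Proof.
move=> cB; pose f s := #|level k n s|.
have right : f c * \sum_(s < B - c) f (c + s) <= 4 * \sum_(s < B - c) f (c + s) ^ 2.
  rewrite -{1}[c]addn0; apply: (logconcave_sum_sq (g := fun s => f (c + s))) => s t _.
  by rewrite mulnC; apply: level_logconcave; lia.
have left : f c * \sum_(s < c.+1) f s <= 4 * \sum_(s < c.+1) f s ^ 2.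
  rewrite -{1}[c]subn0 -(sum_ord_rev f) -(sum_ord_rev (fun s => f s ^ 2)).
  apply: (logconcave_sum_sq (g := fun s => f (c - s))) => s t st.
  by apply: level_logconcave; lia.
rewrite -[X in X * _ <= _]/(f c).
have e1 := sum_ord_shift f (ltnW cB); have e2 := sum_ord_shift (fun s => f s ^ 2) (ltnW cB).
have e3 := sum_ord_shift (fun s => f s ^ 2) cB.
have e4 : \sum_(s < c) f s <= \sum_(s < c.+1) f s by rewrite big_ord_recr leq_addr.
rewrite -/f in e1 e2 e3 *.
have {}e4 := leq_mul (leqnn (f c)) e4.
rewrite (_ : \sum_(s < B) #|_| = \sum_(s < B) f s) // (_ : \sum_(s < B) #|_| ^ 2 = \sum_(s < B) f s ^ 2) //.
by rewrite {1}e1 mulnDr; lia.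
Qed.

Lemma width_double k n : k ^ n * width k n <= 8 * width k (n + n).
Proof.
have half a : a./2 < a.+1 by lia.
have h := level_sum_sq k n (half (n * k.-1)).
rewrite -(sum_level k n) mulnC.
apply: leq_trans (leq_mul (width_level k n) (leqnn _)) _.
apply: leq_trans h _.
by rewrite leq_mul2l sum_level_sq_width orbT.
Qed.

Theorem theorem2p6 :
  exists K : nat, forall (k n : nat), 1 < k -> 1 < n ->
    forall F : {set grid k n},
      (forall u v w : grid k n, u \in F -> v \in F -> w \in F ->
         u != v -> u != w -> v != w -> u <> gjoin v w) ->
      #|F| <= K * width k n.
Proof.
(* For n = 2m the bound is 16 w(n). For n = 2m + 1 the two terms are k^m w(m+1) <= 8 w(n) and
   k^(m+1) w(m) <= 8 k^m w(m+1) <= 64 w(n), with sum 72 w(n). *)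
exists 72 => k n k1 n1.
have [m [m0]] : exists m, 0 < m /\ (n = m + m \/ n = m + m.+1).
  by exists n./2; lia.
have hm := width_double k m.
case=> -> F /union_free_width hF; first by lia.
have hm1 := width_double k m.+1.
have km : 0 < k ^ m by rewrite expn_gt0; lia.
have odd_even : width k (m.+1 + m.+1) <= k * width k (m + m.+1).
  by have := width_add k (m + m.+1) 1; rewrite addn1 expn1.
have even_half : width k (m + m) <= k ^ m.-1 * width k m.+1.
  by have := width_add k m.+1 m.-1; rewrite addSnnS prednK.
have kS : k ^ m = k * k ^ m.-1 by rewrite -expnS prednK.
have h1 : k ^ m * width k m.+1 <= 8 * width k (m + m.+1).
  by rewrite -(leq_pmul2l (ltnW k1)) mulnA -expnS; lia.
have h2 : k ^ m.+1 * width k m <= 8 * (k ^ m * width k m.+1).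
  rewrite expnS -mulnA; apply: leq_trans (leq_mul (leqnn k) hm) _.
  rewrite mulnCA leq_mul2l /= kS -mulnA leq_mul2l even_half orbT //.
by lia.
Qed.
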